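(* Let $R$ be a ring and let $k$ be a natural number. If every element of $R$ can be expressed as a sum of $k$ pairwise commuting periodic elements of $R$, then $R$ is a periodic ring. In particular, every commutative additively periodic ring is periodic.
   Context: All rings are associative with identity; natural numbers are positive integers. An element $r$ of a ring $R$ is periodic if $r^n=r^m$ for some natural numbers $n>m\ge 1$; $R$ is a periodic ring if all its elements are periodic. An element $a\in R$ is additively $k$-periodic if $a$ is a sum of at most $k$ periodic elements of $R$. The ring $R$ is additively periodic if each $a\in R$ is additively $m$-periodic for some natural number $m=m(a)$.
   Formalization: In the second sentence, ''additively periodic'' is read with a number m of summands bounded independently of the element a; with m = m(a) the claim fails for the ring of integers, where every element is a sum of copies of 1 or of -1 but 2 is not periodic. *)

(* Defs.v *)
From HB Require Import structures.
From mathcomp Require Import all_boot all_order all_algebra.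

Set Implicit Arguments.
Unset Strict Implicit.
Unset Printing Implicit Defensive.

Import Order.TTheory GRing.Theory Num.Theory.
Local Open Scope ring_scope.

(* Rings are unital and associative; the zero ring is allowed, hence
   pzRingType rather than nzRingType. *)

Definition periodic (R : pzRingType) (r : R) : Prop :=
  exists m n : nat, [/\ (0 < m)%N, (m < n)%N & r ^+ n = r ^+ m].

Definition periodic_ring (R : pzRingType) : Prop := forall r : R, periodic r.

Definition sum_of_commuting_periodic (R : pzRingType) (k : nat) (a : R) : Prop :=
  exists x : 'I_k -> R,
    [/\ forall i, periodic (x i),
        forall i j, GRing.comm (x i) (x j)
      & a = \sum_(i < k) x i].

Definition additively_kperiodic (R : pzRingType) (k : nat) (a : R) : Prop :=
  exists j : nat, [/\ (0 < j)%N, (j <= k)%N &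
    exists x : 'I_j -> R, (forall i, periodic (x i)) /\ a = \sum_(i < j) x i].

Definition additively_periodic (R : pzRingType) : Prop :=
  forall a : R, exists m : nat, (0 < m)%N /\ additively_kperiodic m a.

(* The number of summands is bounded independently of the element. *)
Definition boundedly_additively_periodic (R : pzRingType) : Prop :=
  exists k : nat, (0 < k)%N /\ forall a : R, additively_kperiodic k a.

(* A bound is indispensable for a commutative additively periodic ring to be
   periodic: every integer is a sum of copies of 1 or of -1, but 2 is not
   periodic. *)
Lemma int_additively_periodic_not_periodic :
  additively_periodic int /\ ~ periodic_ring int.
Proof.
have per (b : bool) : periodic ((-1) ^+ b : int) by exists 1%N, 3%N; case: b.
split=> [a|/(_ 2) [m [n [_ ltmn e2]]]]; last first.
  by have := ltr_eXn2l (isT : 1 < 2 :> int) m n; rewrite e2 ltxx ltmn.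
case: (intP a) => [|n|n].
- exists 1%N; split=> //; exists 1%N; split=> //; exists (fun=> 0).
  by split=> [_|]; [exists 1%N, 2%N | rewrite big1].
- exists n.+1; split=> //; exists n.+1; split=> //; exists (fun=> 1).
  by split=> [_|]; [exact: (per false) | rewrite sumr_const card_ord natz].
exists n.+1; split=> //; exists n.+1; split=> //; exists (fun=> -1).
split=> [_|]; first exact: (per true).
by rewrite sumr_const card_ord mulNrn natz.
Qed.

(* Main.v *)
(* Let a = x_1 + ... + x_k with commuting x_i, and choose m < n such that
   x_i^n = x_i^m for all i.  The finite family w of monomials in the x_i with
   all exponents below n is mapped to itself by multiplication by each x_i and
   contains 1, so multiplication by a acts on w through an integer matrix B,
   nonnegative with all row sums equal to k.
   For a = k + 1 the matrix (k + 1) - B annihilates w; its determinant is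
   nonzero by diagonal dominance, and multiplying by the adjugate shows that
   this determinant kills 1.  Hence R has positive characteristic N.  For
   arbitrary a, all powers of a are then combinations of w with coefficients
   below N; there are finitely many of these, so two powers of a coincide. *)
Require Import Defs.
From mathcomp Require Import all_boot all_order all_algebra.

Set Implicit Arguments.
Unset Strict Implicit.
Unset Printing Implicit Defensive.

Import Order.TTheory GRing.Theory Num.Theory.
Local Open Scope ring_scope.

(** A kernel vector [v] would satisfy [q * v_i = \sum_j B i j * v_j]; at an entry of largest
    absolute value the right-hand side is too small. The transpose turns the row vector given by
    [det0P] into such a [v]. *)
Lemma det_scalar_sub_neq0 (R : realDomainType) n (q : R) (B : 'M[R]_n) :
  (forall i, \sum_j `|B i j| < q) -> \det (q%:M - B) != 0.
Proof.
move=> ltBq; rewrite -det_tr; apply/negP => /det0P[v v_neq0 vB].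
have [i0 _] : exists i0, v 0 i0 != 0.
  by case/matrix0Pn: v_neq0 => z [i0]; rewrite ord1; exists i0.
have [i _ max_i] := real_arg_maxP (I := 'I_n) (i0 := i0) (P := xpredT)
  (F := fun j => `|v 0 j|) isT (fun j _ => normr_real _).
have vi_gt0 : 0 < `|v 0 i|.
  rewrite lt0r normr_ge0 andbT; apply: contraNneq v_neq0 => vi0.
  apply/eqP/rowP => j; rewrite mxE; apply/eqP.
  by rewrite -normr_le0 -vi0; apply: max_i.
have qv : v 0 i * q = \sum_j v 0 j * B i j.
  move/matrixP/(_ 0 i): vB; rewrite linearB /= tr_scalar_mx mulmxBr.
  rewrite mul_mx_scalar !mxE => /subr0_eq; rewrite mulrC => ->.
  by apply: eq_bigr => j _; rewrite mxE.
have q_gt0 : 0 < q by apply: le_lt_trans (ltBq i); apply: sumr_ge0.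
have: `|v 0 i| * q <= `|v 0 i| * \sum_j `|B i j|.
  rewrite -{1}(gtr0_norm q_gt0) -normrM qv mulr_sumr.
  apply: le_trans (ler_norm_sum _ _ _) _; apply: ler_sum => j _.
  by rewrite normrM ler_wpM2r //; apply: max_i.
by rewrite ler_pM2l // leNgt ltBq.
Qed.

(** Cramer's rule over an additive group: multiplying the relations by [\adj A] is written out as a
    double sum, since [w] is not a matrix over [int]. *)
Lemma mulrz_det_eq0 (V : zmodType) n (w : 'I_n -> V) (A : 'M[int]_n) :
  (forall i, \sum_j w j *~ A i j = 0) -> forall l, w l *~ \det A = 0.
Proof.
move=> Aw l.
have -> : w l *~ \det A = \sum_j w j *~ (\adj A *m A) l j.
  rewrite mul_adj_mx (bigD1 l) //= big1 => [|j jl]; first by rewrite !mxE eqxx addr0.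
  by rewrite !mxE eq_sym (negPf jl) mulr0z.
transitivity (\sum_i (\sum_j w j *~ A i j) *~ \adj A l i); last first.
  by rewrite big1 // => i _; rewrite Aw mul0rz.
transitivity (\sum_j \sum_i w j *~ (\adj A l i * A i j)).
  by apply: eq_bigr => j _; rewrite mxE mulrz_sumr.
rewrite exchange_big; apply: eq_bigr => i _ /=.
by rewrite mulrz_suml; apply: eq_bigr => j _; rewrite mulrC mulrzA.
Qed.

Lemma exprD_periodic (R : pzRingType) (r : R) m d M c :
  r ^+ (m + d) = r ^+ m -> (m <= M)%N -> r ^+ (M + d * c) = r ^+ M.
Proof.
move=> rd le_mM; have rD : r ^+ (M + d) = r ^+ M.
  by rewrite -(subnK le_mM) -addnA exprD rd -exprD.
by elim: c => [|c IHc]; rewrite ?muln0 ?addn0 // mulnS addnA exprD rD -exprD.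
Qed.

Lemma common_exponents (R : pzRingType) (I : finType) (x : I -> R) :
  (forall i, periodic (x i)) ->
  exists m n, (m < n)%N /\ forall i, x i ^+ n = x i ^+ m.
Proof.
move=> /fin_all_exists[m] /fin_all_exists[n] mn.
(* [M] is at least every preperiod [m i], and [D] is a positive multiple of every period [d i]. *)
pose d i := (n i - m i)%N; pose M := (\sum_i m i)%N; pose D := (\prod_i d i)%N.
have d_gt0 i : (0 < d i)%N by case: (mn i) => _ ltmn _; rewrite subn_gt0.
exists M, (M + D)%N; split=> [|i].
  by rewrite -addn1 leq_add2l; apply: prodn_gt0.
rewrite /D (bigD1 i) //=; apply: (exprD_periodic (m := m i)).
  by case: (mn i) => _ /ltnW/subnKC-> ->.
by rewrite /M (bigD1 i) //= leq_addr.
Qed.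

Lemma monomialM (R : pzRingType) (I : finType) (x : I -> R) (i : I)
    (f : I -> nat) :
  (forall i j, GRing.comm (x i) (x j)) ->
  x i * \prod_j x j ^+ f j = \prod_j x j ^+ (f j + (j == i)).
Proof.
move=> xC; have {1}-> : x i = \prod_j x j ^+ (j == i).
  by rewrite (big_only1 i) ?eqxx // => j /negPf-> _.
rewrite -prodrM_comm => [|j l _ _]; last first.
  by apply/commrX/commr_sym/commrX/commr_sym.
by apply: eq_bigr => j _; rewrite -exprD addnC.
Qed.

Lemma finite_monomials (R : pzRingType) k (x : 'I_k -> R) :
  (forall i, periodic (x i)) -> (forall i j, GRing.comm (x i) (x j)) ->
  exists p (w : 'I_p -> R) (s : 'I_k -> 'I_p -> 'I_p),
    (exists e, w e = 1) /\ forall i f, x i * w f = w (s i f).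
Proof.
move=> /common_exponents[m [n [ltmn xnm]]] xC.
case: n ltmn xnm => // n ltmn xnm.
pose I := {ffun 'I_k -> 'I_n.+1}; pose w (f : I) := \prod_j x j ^+ f j.
(* Multiplying by [x i] raises one exponent by 1; if it reaches [n.+1], it wraps back to [m], as
   [x j ^+ n.+1 = x j ^+ m]. *)
pose s i (f : I) : I :=
  [ffun j => inord (if (f j + (j == i) == n.+1)%N then m else (f j + (j == i))%N)].
exists #|I|, (w \o enum_val), (fun i => enum_rank \o s i \o enum_val).
split=> [|i f]; last first.
  rewrite /= enum_rankK [in LHS]/w monomialM //; apply: eq_bigr => j _.
  rewrite ffunE; set E := (_ + _)%N.
  have leE : (E <= n.+1)%N.
    by apply: leq_trans (leq_add (leqnn _) (leq_b1 _)) _; rewrite addn1.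
  have [->|neqE] := eqVneq E n.+1; first by rewrite inordK // xnm.
  by rewrite inordK // ltn_neqAle neqE.
exists (enum_rank [ffun=> ord0]); rewrite /= enum_rankK /w big1 // => j _.
by rewrite ffunE.
Qed.

Lemma positive_char (R : pzRingType) k :
  sum_of_commuting_periodic k (k.+1%:R : R) ->
  exists N, (0 < N)%N /\ forall r : R, r *+ N = 0.
Proof.
case=> x [xP xC k1E].
have [p [w [s [[e we] xw]]]] := finite_monomials xP xC.
(* [B i j] counts the [l] for which [s l] sends [i] to [j]. The identity [sumB] serves twice: with
   [u] constantly 1 it gives the row sums, with [u := w] the action of [\sum_l x l]. *)
pose B : 'M[int]_p := \matrix_(i, j) \sum_(l < k) (s l i == j)%:R.
have sumB (V : zmodType) (u : 'I_p -> V) i :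
    \sum_j u j *~ B i j = \sum_(l < k) u (s l i).
  transitivity (\sum_j \sum_(l < k) u j *~ (s l i == j)%:R).
    by apply: eq_bigr => j _; rewrite mxE mulrz_sumr.
  rewrite exchange_big; apply: eq_bigr => l _ /=.
  rewrite (bigD1 (s l i)) //= big1 ?eqxx ?addr0 ?mulr1z // => j.
  by rewrite eq_sym => /negPf->; rewrite mulr0z.
pose A := (k.+1%:R)%:M - B.
have detA_neq0 : \det A != 0.
  apply: det_scalar_sub_neq0 => i.
  rewrite (eq_bigr (fun j => 1 *~ B i j)); last first.
    by move=> j _; rewrite intz ger0_norm // mxE sumr_ge0.
  by rewrite sumB sumr_const card_ord ltr_nat.
have Aw i : \sum_j w j *~ A i j = 0.
  transitivity (\sum_j (w j *~ (k.+1%:R)%:M i j - w j *~ B i j)).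
    by apply: eq_bigr => j _; rewrite !mxE mulrzBr.
  rewrite sumrB sumB (bigD1 i) //= big1 => [|j ji]; last first.
    by rewrite mxE eq_sym (negPf ji) mulr0z.
  rewrite mxE eqxx mulr1n addr0 natz -pmulrn -mulr_natl k1E mulr_suml.
  by rewrite -sumrB big1 // => l _; rewrite xw subrr.
exists `|\det A|%N; split=> [|r]; first by rewrite absz_gt0.
have det0 := mulrz_det_eq0 Aw e; rewrite we in det0.
rewrite -[r]mulr1 -mulrnAr.
suff -> : 1 *+ `|\det A|%N = 0 :> R by rewrite mulr0.
by case: (\det A) det0 => d // /eqP; rewrite NegzE mulrNz oppr_eq0 => /eqP.
Qed.

(** The natural combinations of [w] contain 1 and are stable under each [x i] and under addition,
    hence under multiplication by the sum. *)
Lemma exists_expr_monomials (R : pzRingType) k p (x : 'I_k -> R)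
    (w : 'I_p -> R) (s : 'I_k -> 'I_p -> 'I_p) e :
  w e = 1 -> (forall i f, x i * w f = w (s i f)) ->
  forall t, exists c : 'I_p -> nat, (\sum_i x i) ^+ t = \sum_f w f *+ c f.
Proof.
move=> we xw; pose S b := exists c : 'I_p -> nat, b = \sum_f w f *+ c f.
have S0 : S 0 by exists (fun=> 0); rewrite big1.
have SD b1 b2 : S b1 -> S b2 -> S (b1 + b2).
  move=> [c1 ->] [c2 ->]; exists (fun f => c1 f + c2 f)%N.
  by rewrite -big_split; apply: eq_bigr => f _; rewrite mulrnDr.
have Sw f c : S (w f *+ c).
  exists (fun g => (g == f) * c)%N; rewrite (bigD1 f) //= big1 ?eqxx ?mul1n ?addr0 //.
  by move=> g /negPf->.
elim=> [|t [c tE]]; first by rewrite expr0 -we; apply: Sw 1%N.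
rewrite exprS tE mulr_suml; apply: (big_ind S) => // i _.
rewrite mulr_sumr; apply: (big_ind S) => // f _.
by rewrite mulrnAr xw; apply: Sw.
Qed.

Lemma periodic_sum (R : pzRingType) N k (a : R) :
  (0 < N)%N -> (forall r : R, r *+ N = 0) ->
  sum_of_commuting_periodic k a -> periodic a.
Proof.
move=> N_gt0 rN [x [xP xC aE]].
have [p [w [s [[e we] xw]]]] := finite_monomials xP xC.
have := exists_expr_monomials we xw; rewrite -{}aE => aX.
pose V := [seq \sum_f w f *+ g f | g : {ffun 'I_p -> 'I_N}].
have aV t : a ^+ t \in V.
  have [c ->] := aX t; apply/imageP.
  exists [ffun f => Ordinal (ltn_pmod (c f) N_gt0)] => //.
  apply: eq_bigr => f _; rewrite ffunE /= {1}(divn_eq (c f) N) mulrnDr.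
  by rewrite mulnC mulrnA rN mul0rn add0r.
(* Pigeonhole: one more power than [V] has entries. Exponents start at 1 because [periodic] asks for
   positive ones. *)
pose L := [seq a ^+ t.+1 | t <- iota 0 (size V).+1].
have /(uniqPn 0)[i [j [lt_ij]]] : ~~ uniq L.
  apply/negP => /uniq_leq_size leLV.
  suff /leLV : {subset L <= V} by rewrite size_map size_iota ltnn.
  by move=> _ /mapP[t _ ->].
rewrite size_map size_iota => lt_j.
rewrite !(nth_map 0%N) ?size_iota ?(ltn_trans lt_ij) // !nth_iota ?(ltn_trans lt_ij) //.
by rewrite !add0n => aij; exists i.+1, j.+1.
Qed.

Lemma sum_of_commuting_periodic_kperiodic (R : comPzRingType) k (a : R) :
  additively_kperiodic k a -> sum_of_commuting_periodic k a.
Proof.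
case=> j [_ le_jk [x [xP ->]]].
(* The [j] summands are padded to [k] by zeros, which are periodic. *)
pose y i := if insub i is Some i' then x i' else 0.
exists (y \o val); split=> [i|i l|]; last 1 first.
- rewrite /= -(big_mkord xpredT y) (big_cat_nat _ le_jk) //= [X in _ + X]big_nat.
  rewrite [X in _ + X]big1 ?addr0 => [|i /andP[le_ji _]]; last first.
    by rewrite /y insubN // -leqNgt.
  by rewrite big_mkord; apply: eq_bigr => i _; rewrite /y valK.
- by rewrite /= /y; case: insubP => [u _ _|_]; last by exists 1%N, 2%N; rewrite !expr0n.
- exact: mulrC.
Qed.

Theorem theorem2p5 :
  (forall (R : pzRingType) (k : nat), (0 < k)%N ->
     (forall a : R, sum_of_commuting_periodic k a) -> periodic_ring R)
  /\ (forall R : comPzRingType, boundedly_additively_periodic R -> periodic_ring R).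
Proof.
have main (R : pzRingType) k :
    (forall a : R, sum_of_commuting_periodic k a) -> periodic_ring R.
  move=> sumR r; have [N [N_gt0 rN]] := positive_char (sumR k.+1%:R).
  exact: periodic_sum N_gt0 rN (sumR r).
split=> [R k _|R [k [_ sumR]]]; apply: main => // a.
exact: sum_of_commuting_periodic_kperiodic.
Qed.
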